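(* The probability mass function $h_r^{(III)}(n)$ of the random variable $T_{r,k}^{(III)}$ satisfies the recursive scheme $$\begin{aligned}h_{r}^{(III)}(n)=&\,(\alpha+\beta)h_{r}^{(III)}(n-1)+(1-\alpha-\beta)h_{r}^{(III)}(n-2)-\alpha^{k-1}(1-\alpha)(1-\beta)h_{r}^{(III)}(n-k-1)\\&+\alpha h_{r-1}^{(III)}(n-1)-\alpha(\alpha+\beta)h_{r-1}^{(III)}(n-2)-\alpha(1-\alpha-\beta)h_{r-1}^{(III)}(n-3)\\&+\alpha^{k-1}(1-\alpha)(1-\beta)h_{r-1}^{(III)}(n-k-1),\qquad n>k+1,\end{aligned}$$ with initial conditions $h_{0}^{(III)}(n)=\delta_{n,0}$ and $$h_{1}^{(III)}(n)=\begin{cases}0 & \text{if } 0\le n<k,\\ p\alpha^{k} & \text{if } n=k,\\ q\alpha^{k}(1-\beta) & \text{if } n=k+1,\\ \alpha^{k}(1-\beta)\{\beta q+p(1-\alpha)\} & \text{if } n=k+2.\end{cases}$$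
   Context: $(X_i)_{i\ge1}$ is an infinite sequence of two-state ($0$/$1$) Markov dependent Bernoulli trials with $P(X_i=1)=p$, $P(X_i=0)=1-p=q$, and, for $i>1$, $P(X_i=1\mid X_{i-1}=1)=\alpha$ and $P(X_i=0\mid X_{i-1}=0)=\beta$. $T_{r,k}^{(III)}$ is the waiting time until the $r$-th occurrence of a success run of length $k$ under the overlapping counting scheme (an uninterrupted sequence of $m\ge k$ successes, preceded and followed by a failure or by the beginning or end of the sequence, accounts for $m-k+1$ success runs of length $k$), and $h_r^{(III)}(n)=P(T_{r,k}^{(III)}=n)$. $\delta_{n,0}$ is the Kronecker delta.
   Formalization: The factor α^k in h_1(k), h_1(k+1), h_1(k+2) is corrected to α^{k-1}; the formula for h_1(k+2) is for k≥2, with h_1(3)=qβ(1-β) when k=1; the recursion is asserted for all r≥1, n>k+1 except (r,n)=(1,k+2), where it fails in general. *)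

(* Defs.v *)
From HB Require Import structures.
From mathcomp Require Import all_boot all_order all_algebra.
From mathcomp Require Import all_classical all_reals all_analysis.

Set Implicit Arguments.
Unset Strict Implicit.
Unset Printing Implicit Defensive.

Import Order.TTheory GRing.Theory Num.Theory.

Local Open Scope classical_set_scope.
Local Open Scope ring_scope.

(* Sequences of trials are functions on nat used from index 1 on; the value at
   index 0 is never looked at. Success is true, failure is false. *)

(* Trials a, ..., b form a full success run among the first n trials: they are
   preceded (followed) by a failure or by the beginning (end) of the sequence
   of these n trials. *)
Definition success_run (x : nat -> bool) (n a b : nat) : bool :=
  [&& (0 < a)%N, (a <= b)%N, (b <= n)%N, all x (index_iota a b.+1),
      (a == 1)%N || ~~ x a.-1 & (b == n) || ~~ x b.+1].

(* Overlapping counting: a full run of length m = b - a + 1 >= k accounts for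
   m - k + 1 success runs of length k. *)
Definition overlapping_count (x : nat -> bool) (k n : nat) : nat :=
  (\sum_(1 <= a < n.+1)
     \sum_(a <= b < n.+1 | success_run x n a b && (k <= b - a + 1))
        (b - a + 1 - k + 1))%N.

(* None stands for an infinite waiting time. *)
Definition waiting_time (x : nat -> bool) (k r : nat) : option nat :=
  match pselect (exists n, (r <= overlapping_count x k n)%N) with
  | left ex => Some (ex_minn ex)
  | right _ => None
  end.

Definition cond_prob d (T : measurableType d) (R : realType)
    (P : probability T R) (A B : set T) : R :=
  fine (P (A `&` B)) / fine (P B).

(* Conditional probabilities are only constrained when the conditioning event
   has nonzero probability. *)
Definition markov_bernoulli d (T : measurableType d) (R : realType)
    (P : probability T R) (X : nat -> {RV P >-> bool}) (p alpha beta : R) :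
    Prop :=
  [/\ P [set w | X 1%N w = true] = p%:E,
      forall (i : nat) (x : nat -> bool) (b : bool), (1 <= i)%N ->
        let past := [set w | forall j, (1 <= j <= i)%N -> X j w = x j] in
        P past != 0%E ->
        cond_prob P [set w | X i.+1 w = b] past =
        cond_prob P [set w | X i.+1 w = b] [set w | X i w = x i],
      forall i : nat, (1 < i)%N -> P [set w | X i.-1 w = true] != 0%E ->
        cond_prob P [set w | X i w = true] [set w | X i.-1 w = true] = alpha
    & forall i : nat, (1 < i)%N -> P [set w | X i.-1 w = false] != 0%E ->
        cond_prob P [set w | X i w = false] [set w | X i.-1 w = false] = beta].

Definition waiting_pmf d (T : measurableType d) (R : realType)
    (P : probability T R) (X : nat -> {RV P >-> bool}) (k r n : nat) : R :=
  fine (P [set w | waiting_time (fun i => X i w) k r = Some n]).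

(* Main.v *)
Require Import Defs.
From HB Require Import structures.
From mathcomp Require Import all_boot all_order all_algebra.
From mathcomp Require Import all_classical all_reals all_analysis.
From mathcomp Require Import zify ring.

Set Implicit Arguments.
Unset Strict Implicit.
Unset Printing Implicit Defensive.

Import Order.TTheory GRing.Theory Num.Theory.

Local Open Scope classical_set_scope.
Local Open Scope ring_scope.

(* Write W_n for the number of success runs of length k among the first n
   trials; it increases by one exactly at the times n when the current streak of
   successes has length at least k, so T_r = n means that W_n = r and that such a
   streak ends at n. Put u_r(n) = P(W_n = r, X_n = 0), m_r(n) = P(W_n = r, X_n = 1).
   The Markov property gives, for n >= 1,
     u_r(n+1) = beta u_r(n) + (1-alpha) m_r(n),
     m_r(n+1) = (1-beta) u_r(n) + alpha m_r(n) - h_{r+1}(n+1) + h_r(n+1),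
     h_{r+1}(n+k) = alpha h_r(n+k-1) + (1-beta) alpha^(k-1) u_r(n),
   the last one by asking whether the streak ending at n+k is longer than k.
   Eliminating m and u yields the recurrence for arguments at least k+3; at k+2
   it also uses the values of u_r(1) and m_r(1). *)

(** * Success streaks and the sliding-window form of overlapping counting *)

Fixpoint trail (x : nat -> bool) (n : nat) : nat :=
  if n is m.+1 then if x n then (trail x m).+1 else 0%N else 0%N.

Fixpoint window_count (x : nat -> bool) (k n : nat) : nat :=
  if n is m.+1 then (window_count x k m + (k <= trail x n))%N else 0%N.

(** The half of [success_run] that does not look beyond [b], which allows induction on [b]. *)
Definition run_to (x : nat -> bool) (b a : nat) : bool :=
  all x (index_iota a b.+1) && ((a == 1)%N || ~~ x a.-1).

Lemma all_index_recr (x : nat -> bool) a b : (a <= b.+1)%N ->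
  all x (index_iota a b.+2) = all x (index_iota a b.+1) && x b.+1.
Proof.
move=> ab; rewrite /index_iota subSn // -addn1 iotaD all_cat /= andbT.
by rewrite subnKC.
Qed.

(** For given [b] the only possible start [a] is that of the streak ending at [b], so at most one
    term survives. Extending the streak by a success shifts [f], hence the induction generalises
    over [f]. *)
Lemma sum_run_to (x : nat -> bool) (b : nat) (f : nat -> nat) :
  (\sum_(1 <= a < b.+1) run_to x b a * f (b - a + 1) =
   if trail x b == 0 then 0 else f (trail x b))%N.
Proof.
elim: b f => [|b IH] f; first by rewrite big_geq.
rewrite big_nat_recr //= subnn.
have -> : (run_to x b.+1 b.+1 = x b.+1 && (trail x b == 0))%N.
  rewrite /run_to /index_iota subSnn /= andbT; congr andb.
  by case: b {IH} => [|b] //=; case: (x b.+1).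
have -> : (\sum_(1 <= i < b.+1) run_to x b.+1 i * f (b.+1 - i + 1) =
    x b.+1 * \sum_(1 <= i < b.+1) run_to x b i * f (b - i + 1).+1)%N.
  rewrite big_distrr /=; apply: eq_big_nat => i /andP[i1 ib].
  rewrite /run_to all_index_recr 1?ltnW // subSn // addSn mulnA; congr (_ * _)%N.
  by rewrite mulnb andbCA andbA.
rewrite (IH (fun m => f m.+1)).
case: (x b.+1) => /=; last by rewrite !mul0n.
by rewrite mul1n; case: (trail x b) => [|m] /=; rewrite ?mul0n ?mul1n ?addn0.
Qed.

(* A full run among the first [n] trials either stops at [n] or is closed by a
   failure; [trail x b - k + 1], truncated to 0, is what a run stopping at [b]
   accounts for. *)
Lemma overlapping_count_trail (x : nat -> bool) (k n : nat) : (1 <= k)%N ->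
  overlapping_count x k n =
  (\sum_(1 <= b < n.+1 | (b == n) || ~~ x b.+1) ((trail x b).+1 - k))%N.
Proof.
move=> k1; rewrite /overlapping_count.
(* Truncated subtraction absorbs the condition [k <= b - a + 1]: runs that are too short contribute
   0. The factor [a <= b] makes the range rectangular, so that the sums can be exchanged. *)
transitivity (\sum_(1 <= a < n.+1) \sum_(1 <= b < n.+1)
   (((b == n) || ~~ x b.+1) * ((a <= b) * (run_to x b a * ((b - a + 1).+1 - k)))))%N.
  apply: eq_big_nat => a /andP[a1 an].
  rewrite (@big_nat_widenl _ _ _ a 1) // big_mkcond /=.
  apply: eq_big_nat => b /andP[b1 bn].
  rewrite /success_run /run_to a1 (_ : (b <= n)%N) // -!mulnb.
  have [ab|ab] := leqP a b => //=.
    case: ifP; case: leqP; case: (all _ _); case: (_ || ~~ x a.-1);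
      case: (_ || ~~ x b.+1) => //=; lia.
  by case: (k <= _)%N; rewrite ?mul0n ?muln0.
rewrite exchange_big_nat /= [RHS]big_mkcond; apply: eq_big_nat => b /andP[b1 bn].
rewrite -big_distrr /=.
have -> : (\sum_(1 <= a < n.+1) (a <= b) *
      (run_to x b a * ((b - a + 1).+1 - k)) =
    \sum_(1 <= a < b.+1) run_to x b a * ((b - a + 1).+1 - k))%N.
  rewrite [RHS](@big_nat_widen _ _ _ _ _ n.+1) // [RHS]big_mkcond.
  by apply: eq_bigr => a _; rewrite ltnS; case: leqP; rewrite ?mul1n ?mul0n.
rewrite (sum_run_to x b (fun m => m.+1 - k)%N).
(* For an empty streak the term is [1 - k], which is 0 because [k >= 1]. *)
by case: (_ || _); rewrite ?mul1n ?mul0n //; case: (trail x b) => //=; lia.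
Qed.

(** A failure at [n.+1] closes the run ending at [n] and keeps its term. A success replaces that
    term by the one of a streak longer by one, which is larger by 1 exactly when the new streak has
    length at least [k]. *)
Lemma overlapping_countE (x : nat -> bool) (k n : nat) : (1 <= k)%N ->
  overlapping_count x k n = window_count x k n.
Proof.
move=> k1; rewrite overlapping_count_trail //.
elim: n => [|n IH]; first by rewrite big_geq.
rewrite /= -IH !(big_mkcond (fun b => (b == _) || _)) /= big_nat_recr //= eqxx /=.
case: n {IH} => [|n]; first by rewrite !big_geq //; case: (x 1%N) => /=; lia.
rewrite !(big_nat_recr n.+1) //= eqxx /= eqn_leq ltnn andbF /=.
under eq_big_nat => b /andP[b1 bn].
  by rewrite !(ltn_eqF (_ : b < _)%N) //=; [over|lia].
under [in RHS]eq_big_nat => b /andP[b1 bn].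
  by rewrite (ltn_eqF (_ : b < _)%N) //=; over.
by case: (x n.+2) => /=; lia.
Qed.

Lemma trail_le (x : nat -> bool) (n : nat) : (trail x n <= n)%N.
Proof. by elim: n => //= n IH; case: ifP. Qed.

Lemma window_count_mono (x : nat -> bool) (k : nat) :
  {homo window_count x k : m n / (m <= n)%N}.
Proof.
by apply: homo_leq => [//|m n o|n] /=; [exact: leq_trans|exact: leq_addr].
Qed.

Lemma window_count_gt0 (x : nat -> bool) (k n : nat) : (1 <= k)%N ->
  (k <= trail x n)%N -> (0 < window_count x k n)%N.
Proof. by case: n => [|n] k1 /= h; [lia|rewrite h addn1]. Qed.

(** The count grows by at most one per trial, so it first reaches a positive [r] when it equals [r]
    and has just increased. At [r = n = 0] the equivalence fails: the waiting time is 0, but no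
    streak of length [k] ends there. *)
Lemma waiting_timeE (x : nat -> bool) (k r n : nat) : (1 <= k)%N ->
  (0 < r)%N || (0 < n)%N ->
  (waiting_time x k r = Some n) <->
  (window_count x k n == r) && (k <= trail x n)%N.
Proof.
move=> k1 rn.
have minE (ex : exists n, (r <= overlapping_count x k n)%N) :
    ex_minn ex = n <-> (window_count x k n == r) && (k <= trail x n)%N.
  case: ex_minnP => m; rewrite overlapping_countE // => rm mmin; split.
    move=> mn; move: rn rm mmin; rewrite mn {m mn}.
    case: n => [|n] rn rm mmin; first by move: rn rm => /=; lia.
    have : (window_count x k n < r)%N.
      rewrite ltnNge; apply/negP => rn'.
      by have := mmin n; rewrite overlapping_countE // => /(_ rn'); rewrite ltnn.
    by move: rm => /=; case: (k <= _)%N => /=; lia.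
  case: n rn => [|n] rn /andP[/eqP rE kt]; first by move: kt => /=; lia.
  apply/eqP; rewrite eqn_leq mmin /=; last by rewrite overlapping_countE // rE.
  rewrite ltnNge; apply/negP => /(@window_count_mono x k).
  by move: rE rm => /=; move: kt => /= ->; lia.
rewrite /waiting_time; case: pselect => [ex|nex].
  by split=> [[]/minE //|/minE ->].
split=> // /andP[/eqP rE _]; case: nex; exists n.
by rewrite overlapping_countE // rE.
Qed.

(** * Events decided by finitely many trials *)

Definition adapted (n : nat) (Q : (nat -> bool) -> bool) : Prop :=
  forall x y, (forall j, (1 <= j <= n)%N -> x j = y j) -> Q x = Q y.

Definition cylinder (n : nat) (y x : nat -> bool) : bool :=
  all (fun j => x j == y j) (index_iota 1 n.+1).

Lemma cylinderP (n : nat) (y x : nat -> bool) :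
  reflect (forall j, (1 <= j <= n)%N -> x j = y j) (cylinder n y x).
Proof.
apply: (iffP allP) => [h j jn|h j].
  by apply/eqP/h; rewrite mem_index_iota ltnS.
by rewrite mem_index_iota ltnS => /h ->.
Qed.

Lemma cylinderS (n : nat) (y x : nat -> bool) :
  cylinder n.+1 y x = cylinder n y x && (x n.+1 == y n.+1).
Proof. by rewrite /cylinder all_index_recr. Qed.

Lemma adapted_leq (m n : nat) Q : (m <= n)%N -> adapted m Q -> adapted n Q.
Proof.
move=> mn aQ x y xy; apply: aQ => j /andP[j1 jm]; apply: xy.
by rewrite j1 (leq_trans jm).
Qed.

Lemma adapted_and (n : nat) Q Q' : adapted n Q -> adapted n Q' ->
  adapted n (fun x => Q x && Q' x).
Proof. by move=> aQ aQ' x y xy; rewrite (aQ x y) // (aQ' x y). Qed.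

Lemma adapted_coord (n j : nat) (b : bool) : (1 <= j <= n)%N ->
  adapted n (fun x => x j == b).
Proof. by move=> jn x y ->. Qed.

Lemma adapted_trail (n : nat) (f : nat -> bool) : adapted n (fun x => f (trail x n)).
Proof.
move=> x y xy; congr f; elim: n xy => //= n IH xy.
rewrite xy ?ltnS ?leqnn // IH // => j /andP[j1 jn].
by rewrite xy // j1 (leq_trans jn).
Qed.

Lemma adapted_window_count (k n : nat) (f : nat -> bool) :
  adapted n (fun x => f (window_count x k n)).
Proof.
move=> x y xy; congr f; elim: n xy => // n IH xy.
have /(_ (fun t => k <= t)%N _ _ xy) e := @adapted_trail n.+1.
rewrite /window_count -/window_count; congr (_ + nat_of_bool _)%N => //.
by apply: IH => j /andP[j1 jn]; rewrite xy // j1 (leq_trans jn).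
Qed.

(** An event decided by the first [n] trials is a finite disjoint union of cylinders; restricting
    the union clause to disjoint events suits additivity of probability. *)
Lemma adapted_ind (n : nat) (F : ((nat -> bool) -> bool) -> Prop) :
  F (fun=> false) -> (forall y, F (cylinder n y)) ->
  (forall Q Q', F Q -> F Q' -> (forall x, Q x -> Q' x -> false) ->
    F (fun x => Q x || Q' x)) ->
  forall Q, adapted n Q -> F Q.
Proof.
move=> F0 Fcyl FU Q aQ.
(* The number of coordinates left free is [m]: at [m = 0] the event is a cylinder or empty, at
   [m = n] it is [Q]. *)
suff H m y : F (fun x => Q x && cylinder (n - m) y x).
  have := H n (fun=> false); rewrite subnn.
  by under eq_fun do rewrite andbT.
elim: m y => [|m IH] y.
  rewrite subn0; have -> : (fun x => Q x && cylinder n y x) =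
      (if Q y then cylinder n y else fun=> false).
    apply/funext => x; case cx: (cylinder n y x).
      by rewrite (aQ x y) ?andbT; [case: (Q y)|exact/cylinderP].
    by rewrite andbF; case: (Q y).
  by case: (Q y).
have [nm|mn] := leqP n m.
  by have := IH y; rewrite (_ : n - m = n - m.+1)%N //; lia.
(* Split according to the value of trial [n - m], the next one to be prescribed. *)
pose z b := fun j => if j == (n - m)%N then b else y j.
have -> : (fun x => Q x && cylinder (n - m.+1) y x) =
    (fun x => (Q x && cylinder (n - m) (z true) x) ||
              (Q x && cylinder (n - m) (z false) x)).
  apply/funext => x; rewrite -andb_orr; congr andb.
  rewrite (_ : n - m = (n - m.+1).+1)%N; last by lia.
  rewrite !cylinderS {2 4}/z (_ : (n - m.+1).+1 = (n - m)%N); last by lia.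
  rewrite eqxx.
  have cz b : cylinder (n - m.+1) (z b) x = cylinder (n - m.+1) y x.
    apply: eq_in_all => j; rewrite mem_index_iota => jn.
    by rewrite /z ltn_eqF //; lia.
  by rewrite !cz -andb_orr; case: (x _); rewrite andbT.
apply: FU => // x /andP[_ /cylinderP zt] /andP[_ /cylinderP zf].
have nm : (1 <= n - m <= n - m)%N by lia.
by have := zt _ nm; rewrite (zf _ nm) /z eqxx.
Qed.

(** * Path probabilities and the Markov property *)

Definition path_prob d (T : measurableType d) (R : realType)
    (P : probability T R) (X : nat -> {RV P >-> bool})
    (Q : (nat -> bool) -> bool) : R :=
  fine (P [set w | Q (fun i => X i w)]).

Definition transition (R : realType) (alpha beta : R) (b c : bool) : R :=
  if b then if c then alpha else 1 - alpha else if c then 1 - beta else beta.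

Lemma measurable_coord d (T : measurableType d) (R : realType)
    (P : probability T R) (X : nat -> {RV P >-> bool}) (j : nat) (b : bool) :
  measurable [set w | X j w = b].
Proof.
have := @measurable_funPTI _ _ _ _ (X j) [set b].
by apply.
Qed.

Lemma measurable_cylinder d (T : measurableType d) (R : realType)
    (P : probability T R) (X : nat -> {RV P >-> bool}) (n : nat) (y : nat -> bool) :
  measurable [set w | cylinder n y (fun i => X i w)].
Proof.
elim: n => [|n IH].
  by rewrite (_ : [set _ | _] = setT) //; apply/seteqP; split.
rewrite (_ : [set _ | _] = [set w | cylinder n y (fun i => X i w)] `&`
    [set w | X n.+1 w = y n.+1]).
  exact: measurableI IH (measurable_coord _ _ _).
apply/seteqP; split=> w /=; rewrite cylinderS; first by move=> /andP[? /eqP].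
by case=> -> ->; rewrite eqxx.
Qed.

Lemma measurable_adapted d (T : measurableType d) (R : realType)
    (P : probability T R) (X : nat -> {RV P >-> bool}) (n : nat) Q :
  adapted n Q -> measurable [set w | Q (fun i => X i w)].
Proof.
move: Q; apply: (@adapted_ind n
  (fun Q => measurable [set w | Q (fun i => X i w)])) => [|y|Q Q' mQ mQ' _].
- by rewrite (_ : [set _ | _] = set0) //; apply/seteqP; split.
- exact: measurable_cylinder.
- rewrite (_ : [set _ | _] = [set w | Q (fun i => X i w)] `|`
      [set w | Q' (fun i => X i w)]); first exact: measurableU.
  by apply/seteqP; split=> w /= /orP.
Qed.

Lemma path_probU d (T : measurableType d) (R : realType)
    (P : probability T R) (X : nat -> {RV P >-> bool}) (n : nat) Q Q' :
  adapted n Q -> adapted n Q' -> (forall x, Q x -> Q' x -> false) ->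
  path_prob X (fun x => Q x || Q' x) = path_prob X Q + path_prob X Q'.
Proof.
move=> /(measurable_adapted X) mQ /(measurable_adapted X) mQ' dQ.
rewrite /path_prob -fineD ?fin_num_measure // -measureU //.
  by congr (fine (P _)); apply/seteqP; split=> w /= /orP.
by apply/seteqP; split=> w //= -[/dQ/[apply]].
Qed.

Lemma path_prob_split d (T : measurableType d) (R : realType)
    (P : probability T R) (X : nat -> {RV P >-> bool}) (n : nat) Q Q' :
  adapted n Q -> adapted n Q' ->
  path_prob X Q =
  path_prob X (fun x => Q x && Q' x) + path_prob X (fun x => Q x && ~~ Q' x).
Proof.
move=> aQ aQ'; rewrite -(@path_probU _ _ _ _ _ n).
- by congr path_prob; apply/funext => x; rewrite -andb_orr orbN andbT.
- exact: adapted_and.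
- by apply: adapted_and => // x y xy; rewrite (aQ' x y).
- by move=> x /andP[_ ->] /andP[].
Qed.

Lemma path_prob0 d (T : measurableType d) (R : realType)
    (P : probability T R) (X : nat -> {RV P >-> bool}) :
  path_prob X (fun=> false) = 0.
Proof.
by rewrite /path_prob (_ : [set _ | _] = set0) ?measure0 //; apply/seteqP; split.
Qed.

(** The model prescribes only the diagonal entries [alpha] and [beta]; the other two follow by
    complementation. *)
Lemma cond_prob_coord d (T : measurableType d) (R : realType)
    (P : probability T R) (X : nat -> {RV P >-> bool}) (p alpha beta : R)
    (n : nat) (b c : bool) :
  markov_bernoulli X p alpha beta -> (1 <= n)%N ->
  P [set w | X n w = b] != 0%E ->
  cond_prob P [set w | X n.+1 w = c] [set w | X n w = b] = transition alpha beta b c.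
Proof.
move=> [_ _ ht hf] n1 Pb.
have fb : fine (P [set w | X n w = b]) != 0.
  by rewrite fine_eq0 // fin_num_measure //; exact: measurable_coord.
have compl : cond_prob P [set w | X n.+1 w = c] [set w | X n w = b] =
    1 - cond_prob P [set w | X n.+1 w = ~~ c] [set w | X n w = b].
  apply/eqP; rewrite eq_sym subr_eq eq_sym /cond_prob -mulrDl -fineD;
    try by apply: fin_num_measure; apply: measurableI; exact: measurable_coord.
  rewrite -measureU; try by apply: measurableI; exact: measurable_coord.
    rewrite -setIUl (_ : _ `|` _ = setT) ?setTI ?divff //.
    by apply/seteqP; split=> w //= _; case: (X n.+1 w) c => -[]; auto.
  by apply/seteqP; split=> w //= -[[-> _] [+ _]]; case: c.
case: b Pb fb compl => Pb fb compl; rewrite /transition.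
  case: c compl => compl; first exact: (ht n.+1).
  by rewrite compl (ht n.+1).
case: c compl => compl; last exact: (hf n.+1).
by rewrite compl (hf n.+1).
Qed.

Lemma path_prob_cylinderS d (T : measurableType d) (R : realType)
    (P : probability T R) (X : nat -> {RV P >-> bool}) (p alpha beta : R)
    (n : nat) (y : nat -> bool) :
  markov_bernoulli X p alpha beta -> (1 <= n)%N ->
  path_prob X (cylinder n.+1 y) =
  path_prob X (cylinder n y) * transition alpha beta (y n) (y n.+1).
Proof.
move=> hX n1; rewrite /path_prob.
set A := [set w | cylinder n y _].
have mA : measurable A := measurable_cylinder X n y.
have -> : [set w | cylinder n.+1 y (fun i => X i w)] =
    [set w | X n.+1 w = y n.+1] `&` A.
  apply/seteqP; split=> w /=; rewrite cylinderS; first by move=> /andP[? /eqP].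
  by case=> /eqP -> ->.
(* On a null cylinder the conditional law is unconstrained, but both sides vanish. *)
have [A0|An0] := eqVneq (P A) 0%E.
  rewrite A0 mul0r (_ : P _ = 0%E) //; apply/eqP; rewrite -measure_le0 -A0.
  apply: le_measure; rewrite ?inE //.
  by apply: measurableI => //; exact: measurable_coord.
have Pn0 : P [set w | X n w = y n] != 0%E.
  apply: contra An0 => /eqP B0; rewrite -measure_le0 -B0.
  apply: le_measure; rewrite ?inE //; first exact: measurable_coord.
  by move=> w /cylinderP /(_ n); rewrite n1 leqnn; apply.
have fA : fine (P A) != 0 by rewrite fine_eq0 // fin_num_measure.
have [_ /(_ n y (y n.+1) n1) + _ _] := hX.
rewrite (_ : [set w | forall j, _] = A); last first.
  by apply/seteqP; split=> w /cylinderP.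
move=> /(_ An0); rewrite (cond_prob_coord _ hX n1 Pn0) /cond_prob => <-.
by rewrite mulrC divfK.
Qed.

(** The rule for cylinders extends by additivity; since [Q] fixes the state at [n], all its
    cylinders share one transition factor. *)
Lemma path_prob_markov d (T : measurableType d) (R : realType)
    (P : probability T R) (X : nat -> {RV P >-> bool}) (p alpha beta : R)
    (n : nat) (b c : bool) Q :
  markov_bernoulli X p alpha beta -> (1 <= n)%N -> adapted n Q ->
  (forall x, Q x -> x n = b) ->
  path_prob X (fun x => Q x && (x n.+1 == c)) =
  path_prob X Q * transition alpha beta b c.
Proof.
move=> hX n1 aQ Qb.
have -> : Q = (fun x => Q x && (x n == b)).
  by apply/funext => x; case: (boolP (Q x)) => //= /Qb ->; rewrite eqxx.
move: Q aQ {Qb}.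
(* Adaptedness is carried through the induction because additivity of [path_prob] requires it. *)
suff H : forall Q, adapted n Q -> adapted n Q /\
    path_prob X (fun x => (Q x && (x n == b)) && (x n.+1 == c)) =
    path_prob X (fun x => Q x && (x n == b)) * transition alpha beta b c.
  by move=> Q /H[].
apply: adapted_ind => [|y|Q Q' [aQ IQ] [aQ' IQ'] dQ].
- by rewrite path_prob0 mul0r.
- split.
    by move=> x z xz; apply: eq_in_all => j; rewrite mem_index_iota => /xz ->.
  (* A cylinder whose state at [n] is not [b] contributes 0 to both sides. *)
  have [yb|yb] := eqVneq (y n) b; last first.
    have c0 x : cylinder n y x && (x n == b) = false.
      apply/andP => -[/cylinderP/(_ n)]; rewrite n1 leqnn => -> //.
      by apply/negP.
    under eq_fun do rewrite c0.
    under [in RHS]eq_fun do rewrite c0.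
    by rewrite path_prob0 mul0r.
  have cE x : cylinder n y x && (x n == b) = cylinder n y x.
    case: (boolP (cylinder n y x)) => // /cylinderP/(_ n).
    by rewrite n1 leqnn yb => -> //; rewrite eqxx.
  under eq_fun do rewrite cE.
  under [in RHS]eq_fun do rewrite cE.
  pose z j := if j == n.+1 then c else y j.
  have cz x : cylinder n y x = cylinder n z x.
    apply: eq_in_all => j; rewrite mem_index_iota => /andP[_ jn].
    by rewrite /z ltn_eqF.
  have -> : (fun x => cylinder n y x && (x n.+1 == c)) = cylinder n.+1 z.
    by apply/funext => x; rewrite cylinderS cz {3}/z eqxx.
  rewrite (path_prob_cylinderS _ hX n1) {2 3}/z eqxx ltn_eqF // yb.
  by congr (path_prob X _ * _); apply/funext => x; rewrite cz.
- split; first by move=> x y xy; rewrite (aQ x y) // (aQ' x y).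
  have -> : (fun x => (Q x || Q' x) && (x n == b)) =
      (fun x => Q x && (x n == b) || Q' x && (x n == b)).
    by apply/funext => x; rewrite andb_orl.
  have -> : (fun x => (Q x || Q' x) && (x n == b) && (x n.+1 == c)) =
      (fun x => (Q x && (x n == b)) && (x n.+1 == c) ||
                (Q' x && (x n == b)) && (x n.+1 == c)).
    by apply/funext => x; rewrite !andb_orl.
  have aS R' : adapted n R' -> adapted n (fun x => R' x && (x n == b)).
    by move=> aR; apply: adapted_and => //; apply: adapted_coord; rewrite n1 leqnn.
  rewrite (@path_probU _ _ _ _ _ n.+1); last 3 first.
  - apply: adapted_and; last by apply: adapted_coord; rewrite ltnSn.
    by apply: adapted_leq (aS _ aQ).
  - apply: adapted_and; last by apply: adapted_coord; rewrite ltnSn.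
    by apply: adapted_leq (aS _ aQ').
  - by move=> x /andP[/andP[/dQ dx _] _] /andP[/andP[/dx]].
  rewrite (@path_probU _ _ _ _ _ n); [|exact: aS|exact: aS|]; last first.
    by move=> x /andP[/dQ dx _] /andP[/dx].
  by rewrite IQ IQ' mulrDl.
Qed.

(** * The joint evolution of the window count and the last trial *)

Definition ends_failing (k r n : nat) (x : nat -> bool) : bool :=
  (window_count x k n == r) && (x n == false).

Definition ends_succeeding (k r n : nat) (x : nat -> bool) : bool :=
  (window_count x k n == r) && (x n == true).

Definition completes_window (k r n : nat) (x : nat -> bool) : bool :=
  (window_count x k n == r) && (k <= trail x n)%N.

(* For [j <= k], the last [j] trials extend a state with [r] windows by [j]
   successes, completing one more window only if [j = k]. *)
Definition ends_run (k r j n : nat) (x : nat -> bool) : bool :=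
  (trail x n == j) && (window_count x k n == r + (j == k))%N.

Lemma waiting_pmfE d (T : measurableType d) (R : realType)
    (P : probability T R) (X : nat -> {RV P >-> bool}) (k r n : nat) :
  (1 <= k)%N -> (0 < r)%N || (0 < n)%N ->
  waiting_pmf X k r n = path_prob X (completes_window k r n).
Proof.
move=> k1 rn; congr (fine (P _)).
by apply/seteqP; split=> w /(waiting_timeE _ k1 rn).
Qed.

Lemma waiting_pmf0 d (T : measurableType d) (R : realType)
    (P : probability T R) (X : nat -> {RV P >-> bool}) (k n : nat) :
  waiting_pmf X k 0 n = (n == 0%N)%:R.
Proof.
have wt x : waiting_time x k 0 = Some 0%N.
  rewrite /waiting_time; case: pselect => [ex|[]]; last by exists 0%N.
  by congr Some; case: ex_minnP => m _ /(_ 0%N); case: m => // m /(_ isT).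
rewrite /waiting_pmf; case: n => [|n] /=.
  rewrite (_ : [set _ | _] = setT) ?probability_setT //.
  by apply/seteqP; split=> w //= _; rewrite wt.
rewrite (_ : [set _ | _] = set0) ?measure0 //.
by apply/seteqP; split=> w //=; rewrite wt.
Qed.

(** Each window ends at one of the trials [k], ..., [n], so at most [n.+1 - k] of them fit; a
    completed one makes the count positive. *)
Lemma completes_window_eq0 (k r n : nat) (x : nat -> bool) :
  (1 <= k)%N -> (n.+1 < k + r)%N || (r == 0)%N -> completes_window k r n x = false.
Proof.
move=> k1 nr; apply/negP => /andP[/eqP rE kt].
have := window_count_gt0 k1 kt.
suff : (window_count x k n <= n.+1 - k)%N by lia.
elim: {nr rE kt} n => [|n IH]; first by rewrite /=; lia.
have /= := trail_le x n.+1; case: leqP; lia.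
Qed.

Lemma path_prob_next d (T : measurableType d) (R : realType)
    (P : probability T R) (X : nat -> {RV P >-> bool}) (p alpha beta : R)
    (n : nat) (c : bool) Q :
  markov_bernoulli X p alpha beta -> (1 <= n)%N -> adapted n Q ->
  path_prob X (fun x => Q x && (x n.+1 == c)) =
  path_prob X (fun x => Q x && (x n == true)) * transition alpha beta true c +
  path_prob X (fun x => Q x && (x n == false)) * transition alpha beta false c.
Proof.
move=> hX n1 aQ.
have ax b : adapted n (fun x => x n == b) by apply: adapted_coord; rewrite n1 leqnn.
rewrite -!(path_prob_markov _ hX n1 (adapted_and aQ (ax _))) //;
  try by move=> x /andP[_ /eqP].
rewrite -(@path_probU _ _ _ _ _ n.+1).
- congr path_prob; apply/funext => x.
  by case: (Q x); case: (x n); case: (x n.+1 == c).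
- apply: adapted_and; last by apply: adapted_coord; rewrite ltnSn.
  exact: adapted_leq (adapted_and aQ (ax _)).
- apply: adapted_and; last by apply: adapted_coord; rewrite ltnSn.
  exact: adapted_leq (adapted_and aQ (ax _)).
- by move=> x /andP[/andP[_ /eqP ->] _] /andP[/andP[]].
Qed.

Lemma ends_failingS d (T : measurableType d) (R : realType)
    (P : probability T R) (X : nat -> {RV P >-> bool}) (p alpha beta : R)
    (k r n : nat) :
  markov_bernoulli X p alpha beta -> (1 <= k)%N -> (1 <= n)%N ->
  path_prob X (ends_failing k r n.+1) =
  beta * path_prob X (ends_failing k r n) +
  (1 - alpha) * path_prob X (ends_succeeding k r n).
Proof.
move=> hX k1 n1.
have -> : ends_failing k r n.+1 =
    (fun x => (window_count x k n == r) && (x n.+1 == false)).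
  apply/funext => x; rewrite /ends_failing /=; case: (x n.+1); rewrite ?andbF //.
  by rewrite leqn0 (_ : k == 0 = false)%N ?addn0 //; lia.
rewrite (path_prob_next _ hX n1 (@adapted_window_count k n (fun c => c == r))).
by rewrite addrC /= ![_ * path_prob _ _]mulrC.
Qed.

(** Fix a success at [n.+1] and compare count [r] before it with count [r] after it. The two events
    agree where no window is completed; where one is, they are completions of window [r.+1] and of
    window [r]. *)
Lemma ends_succeedingS d (T : measurableType d) (R : realType)
    (P : probability T R) (X : nat -> {RV P >-> bool}) (p alpha beta : R)
    (k r n : nat) :
  markov_bernoulli X p alpha beta -> (1 <= k)%N -> (1 <= n)%N ->
  path_prob X (ends_succeeding k r n.+1) =
  (1 - beta) * path_prob X (ends_failing k r n) +
  alpha * path_prob X (ends_succeeding k r n) -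
  path_prob X (completes_window k r.+1 n.+1) +
  path_prob X (completes_window k r n.+1).
Proof.
move=> hX k1 n1.
pose Q x := (window_count x k n == r) && (x n.+1 == true).
pose W x := (k <= trail x n.+1)%N.
have aW : adapted n.+1 W by apply: (@adapted_trail n.+1 (fun t => k <= t)%N).
have aQ : adapted n.+1 Q.
  apply: adapted_and; last by apply: adapted_coord; rewrite ltnSn.
  apply: adapted_leq (leqnSn n) _.
  exact: (@adapted_window_count k n (fun c => c == r)).
have aS : adapted n.+1 (ends_succeeding k r n.+1).
  apply: adapted_and; last by apply: adapted_coord; rewrite ltnSn.
  exact: (@adapted_window_count k n.+1 (fun c => c == r)).
have k0 : (k <= 0)%N = false by lia.
have := path_prob_next true hX n1 (@adapted_window_count k n (fun c => c == r)).
rewrite -/Q [path_prob X Q](path_prob_split X aQ aW) (path_prob_split X aS aW).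
have -> : (fun x => Q x && W x) = completes_window k r.+1 n.+1.
  apply/funext => x; rewrite /Q /W /completes_window /=.
  case: (x n.+1); rewrite ?k0 ?andbF //= andbT.
  by case: leqP; rewrite ?andbF ?addn1.
have -> : (fun x => ends_succeeding k r n.+1 x && W x) = completes_window k r n.+1.
  apply/funext => x; rewrite /ends_succeeding /W /completes_window /=.
  by case: (x n.+1); rewrite ?k0 ?andbF ?andbT.
have -> : (fun x => ends_succeeding k r n.+1 x && ~~ W x) = (fun x => Q x && ~~ W x).
  apply/funext => x; rewrite /Q /ends_succeeding /W /=.
  by case: leqP; rewrite ?andbF ?addn0.
move=> /= /(canRL (addKr _)) ->.
rewrite /ends_failing /ends_succeeding; ring.
Qed.

Lemma ends_runS (k r j n : nat) : (j < k)%N ->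
  ends_run k r j.+1 n.+1 = (fun x => ends_run k r j n x && (x n.+1 == true)).
Proof.
move=> jk; apply/funext => x; rewrite /ends_run /= (ltn_eqF jk) addn0.
case: (x n.+1); rewrite ?andbF ?andbT // eqSS.
case: eqP => //= ->; rewrite [j.+1 == k]eqn_leq jk /=.
by case: leqP => _; rewrite ?addn1 ?addn0 // eqSS.
Qed.

Lemma adapted_ends_run (k r j n : nat) : adapted n (ends_run k r j n).
Proof.
apply: adapted_and; first exact: (@adapted_trail n (fun t => t == j)).
exact: (@adapted_window_count k n (fun c => c == r + (j == k))%N).
Qed.

(** Every success after the first costs a factor [alpha]. The first is kept apart: it costs
    [1 - beta] after a failure but [p] at the beginning. *)
Lemma path_prob_ends_run d (T : measurableType d) (R : realType)
    (P : probability T R) (X : nat -> {RV P >-> bool}) (p alpha beta : R)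
    (k r n j : nat) :
  markov_bernoulli X p alpha beta -> (j < k)%N ->
  path_prob X (ends_run k r j.+1 (n + j).+1) =
  path_prob X (ends_run k r 1 n.+1) * alpha ^+ j.
Proof.
move=> hX; elim: j => [|j IH] jk; first by rewrite addn0 expr0 mulr1.
rewrite ends_runS // addnS.
rewrite (path_prob_markov (b := true) _ hX _ (@adapted_ends_run _ _ _ _)) //; last first.
  by move=> x /andP[/=]; case: (x _).
by rewrite IH 1?ltnW //= exprSr mulrA.
Qed.

Lemma completes_windowS d (T : measurableType d) (R : realType)
    (P : probability T R) (X : nat -> {RV P >-> bool}) (p alpha beta : R)
    (k r n : nat) :
  markov_bernoulli X p alpha beta -> (1 <= k)%N -> (1 <= n)%N ->
  path_prob X (completes_window k r.+1 (n + k)) =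
  alpha * path_prob X (completes_window k r (n + k - 1)) +
  (1 - beta) * alpha ^+ (k - 1) * path_prob X (ends_failing k r n).
Proof.
case: k => // k hX _ n1; rewrite addnS !subn1 /=.
(* The window length is now [k.+1]. A longer streak means that the preceding trial already completed
   window [r]; a streak of exactly this length starts right after trial [n]. *)
have -> : path_prob X (completes_window k.+1 r.+1 (n + k).+1) =
    path_prob X (fun x => completes_window k.+1 r (n + k) x && (x (n + k).+1 == true)) +
    path_prob X (ends_run k.+1 r k.+1 (n + k).+1).
  rewrite -(@path_probU _ _ _ _ _ (n + k).+1).
  - congr path_prob; apply/funext => x; rewrite /completes_window /ends_run /= eqxx.
    case: (x _); rewrite ?andbF ?andbT //= ltnS eqSS addn1.
    case: (ltngtP k (trail x (n + k))) => h; rewrite ?andbF ?andbT ?orbF //=.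
    by rewrite addn1 eqSS.
  - apply: adapted_and; last by apply: adapted_coord; rewrite ltnSn.
    apply: adapted_leq (leqnSn _) _; apply: adapted_and.
      exact: (@adapted_window_count _ _ (fun c => c == r)).
    exact: (@adapted_trail _ (fun t => k < t)%N).
  - exact: adapted_ends_run.
  - move=> x /andP[/andP[_ kt] xt] /andP[] /=.
    by rewrite (eqP xt) eqSS => /eqP kt'; rewrite kt' ltnn in kt.
rewrite (path_prob_markov (b := true) _ hX); last 3 first.
- by lia.
- apply: adapted_and; first exact: (@adapted_window_count _ _ (fun c => c == r)).
  exact: (@adapted_trail _ (fun t => k < t)%N).
- by case: (n + k)%N => [|m] x /andP[_] //=; case: (x m.+1).
rewrite (path_prob_ends_run _ _ hX) //.
rewrite ends_runS //.
rewrite (path_prob_markov (b := false) _ hX n1 (@adapted_ends_run _ _ _ _)).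
  (* An empty streak means a failure because [n >= 1]. *)
  rewrite /= (_ : ends_run k.+1 r 0 n = ends_failing k.+1 r n); first by ring.
  apply/funext => x; rewrite /ends_run /ends_failing addn0 andbC; congr andb.
  by case: n n1 => //= n _; case: (x _).
by move=> x /andP[+ _]; case: n n1 => //= n _; case: (x _).
Qed.

(* Eliminating [m] from the first two equations gives a second-order recurrence
   for [u], and the third one expresses [u] through [h]. *)
Lemma eliminate_states (R : comRingType) (alpha beta A : R) (k : nat)
    (u m h h' : nat -> R) :
  (forall n, (1 <= n)%N -> u n.+1 = beta * u n + (1 - alpha) * m n) ->
  (forall n, (1 <= n)%N ->
    m n.+1 = (1 - beta) * u n + alpha * m n - h' n.+1 + h n.+1) ->
  (forall n, (1 <= n)%N -> h' (n + k)%N = alpha * h (n + k - 1)%N + A * u n) ->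
  forall n, (1 <= n)%N ->
  h' (n.+2 + k)%N =
    (alpha + beta) * h' (n.+1 + k)%N + (1 - alpha - beta) * h' (n + k)%N
    - A * (1 - alpha) * h' n.+1
    + alpha * h (n.+1 + k)%N
    - alpha * (alpha + beta) * h (n + k)%N
    - alpha * (1 - alpha - beta) * h (n + k - 1)%N
    + A * (1 - alpha) * h n.+1.
Proof.
move=> hu hm hh n n1.
rewrite !hh // !addSn !subn1 /= hu // hm //.
have := hu n n1 => un.
rewrite un; ring.
Qed.

(** * Initial values, and the recurrence assembled from them *)

Lemma path_prob_first d (T : measurableType d) (R : realType)
    (P : probability T R) (X : nat -> {RV P >-> bool}) (p alpha beta : R) (b : bool) :
  markov_bernoulli X p alpha beta ->
  path_prob X (fun x => x 1%N == b) = if b then p else 1 - p.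
Proof.
case=> hp _ _ _.
have pt : path_prob X (fun x => x 1%N == true) = p.
  rewrite /path_prob (_ : [set _ | _] = [set w | X 1%N w = true]) ?hp //.
  by apply/seteqP; split=> w /= /eqP.
case: b => //; rewrite -{1}pt; apply/eqP; rewrite eq_sym subr_eq addrC.
have <- : path_prob X (fun=> true) = 1.
  rewrite /path_prob (_ : [set _ | _] = setT) ?probability_setT //.
  by apply/seteqP; split.
have ax b : adapted 1 (fun x => x 1%N == b) by apply: adapted_coord.
rewrite -(path_probU X (ax true) (ax false)); last by move=> x /eqP ->.
by apply/eqP; congr path_prob; apply/funext => x; case: (x 1%N).
Qed.

Lemma ends_failing1 d (T : measurableType d) (R : realType)
    (P : probability T R) (X : nat -> {RV P >-> bool}) (p alpha beta : R)
    (k r : nat) :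
  markov_bernoulli X p alpha beta -> (1 <= k)%N ->
  path_prob X (ends_failing k r 1) = if (r == 0)%N then 1 - p else 0.
Proof.
move=> hX k1.
have -> : ends_failing k r 1 = (fun x => (r == 0)%N && (x 1%N == false)).
  apply/funext => x; rewrite /ends_failing /=; case: (x 1%N); rewrite ?andbF //.
  by rewrite leqn0 -[k == 0]negbK -lt0n k1 eq_sym.
by case: eqP => _ /=; [exact: path_prob_first hX|exact: path_prob0].
Qed.

(** For [k = 1] a success on trial 1 already completes a window; this is why the value at [k + 2]
    depends on whether [k = 1]. *)
Lemma ends_succeeding1 d (T : measurableType d) (R : realType)
    (P : probability T R) (X : nat -> {RV P >-> bool}) (p alpha beta : R)
    (k : nat) :
  markov_bernoulli X p alpha beta ->
  path_prob X (ends_succeeding k 0 1) = if (1 < k)%N then p else 0.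
Proof.
move=> hX.
have -> : ends_succeeding k 0 1 = (fun x => (1 < k)%N && (x 1%N == true)).
  apply/funext => x; rewrite /ends_succeeding /=; case: (x 1%N); rewrite ?andbF //.
  by case: ltnP.
by case: ltnP => _ /=; [exact: path_prob_first hX|exact: path_prob0].
Qed.

Lemma ends_succeeding1_completes (k r : nat) : (1 <= k)%N -> (1 <= r)%N ->
  ends_succeeding k r 1 = completes_window k r 1.
Proof.
move=> k1 r1; apply/funext => x; rewrite /ends_succeeding /completes_window /=.
case: (x 1%N); rewrite /= ?andbF ?andbT.
  by case: leqP; rewrite ?andbF ?andbT // add0n; case: r r1.
by rewrite leqn0 (_ : (k == 0)%N = false) ?andbF //; lia.
Qed.

(** All [k] trials must succeed: the first costs [p], each of the other [k - 1] costs [alpha]. *)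
Lemma completes_window_first d (T : measurableType d) (R : realType)
    (P : probability T R) (X : nat -> {RV P >-> bool}) (p alpha beta : R)
    (k : nat) :
  markov_bernoulli X p alpha beta -> (1 <= k)%N ->
  path_prob X (completes_window k 1 k) = p * alpha ^+ (k - 1).
Proof.
case: k => // k hX _; rewrite subn1.
have -> : completes_window k.+1 1 k.+1 = ends_run k.+1 0 k.+1 (0 + k).+1.
  apply/funext => x; rewrite /completes_window /ends_run andbC eqxx; congr andb.
  by rewrite eqn_leq trail_le.
rewrite (path_prob_ends_run _ _ hX) // -(path_prob_first true hX).
by congr (path_prob X _ * _); apply/funext => x; rewrite ends_runS // /ends_run.
Qed.

(** At [(1, k + 2)] the one-trial values are those of count 0, where a failure has probability [q];
    this case is covered by an initial condition instead of the recurrence. *)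
Theorem theorem3p16 (d : measure_display) (T : measurableType d) (R : realType)
    (P : probability T R) (X : nat -> {RV P >-> bool}) (p q alpha beta : R)
    (k : nat) (hq : q = 1 - p) (hX : markov_bernoulli X p alpha beta)
    (hk : (1 <= k)%N) :
  let h := waiting_pmf X k in
  [/\ forall r n : nat, (1 <= r)%N -> (k + 1 < n)%N ->
        (r, n) <> (1%N, (k + 2)%N) ->
        h r n =
          (alpha + beta) * h r (n - 1)%N
          + (1 - alpha - beta) * h r (n - 2)%N
          - alpha ^+ (k - 1) * (1 - alpha) * (1 - beta) * h r (n - k - 1)%N
          + alpha * h (r - 1)%N (n - 1)%N
          - alpha * (alpha + beta) * h (r - 1)%N (n - 2)%N
          - alpha * (1 - alpha - beta) * h (r - 1)%N (n - 3)%N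
          + alpha ^+ (k - 1) * (1 - alpha) * (1 - beta)
            * h (r - 1)%N (n - k - 1)%N,
      forall n : nat, h 0%N n = (n == 0%N)%:R
    & [/\ forall n : nat, (n < k)%N -> h 1%N n = 0,
          h 1%N k = p * alpha ^+ (k - 1),
          h 1%N (k + 1)%N = q * alpha ^+ (k - 1) * (1 - beta),
          (1 < k)%N ->
            h 1%N (k + 2)%N =
              alpha ^+ (k - 1) * (1 - beta) * (beta * q + p * (1 - alpha))
        & k = 1%N -> h 1%N (k + 2)%N = q * beta * (1 - beta)]].
Proof.
move=> h.
pose H r n := path_prob X (completes_window k r n).
have hE r n : (0 < r)%N || (0 < n)%N -> h r n = H r n by exact: waiting_pmfE.
have H0 r n : (n.+1 < k + r)%N || (r == 0)%N -> H r n = 0.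
  move=> rn; rewrite /H -[RHS](path_prob0 X); congr path_prob.
  by apply/funext => x; exact: completes_window_eq0.
have HS r n : (1 <= n)%N -> H r.+1 (n + k)%N = alpha * H r (n + k - 1)%N +
    (1 - beta) * alpha ^+ (k - 1) * path_prob X (ends_failing k r n).
  exact: completes_windowS hX hk.
(* The last factor is u_0(2), obtained from u_0(1) and m_0(1). *)
have h1 : h 1%N (k + 2)%N = (1 - beta) * alpha ^+ (k - 1) *
    (beta * q + (1 - alpha) * if (1 < k)%N then p else 0).
  rewrite hE // addnC HS // H0 ?orbT // mulr0 add0r (ends_failingS _ hX) //.
  by rewrite (ends_failing1 _ hX) // (ends_succeeding1 _ hX) /= hq.
split.
- case=> // r n _ kn rn; rewrite (_ : r.+1 - 1 = r)%N; last by lia.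
  (* After the shift of [r], this keeps all arguments of [h 0] positive, where [h] and [H] agree. *)
  have {}rn : (0 < r)%N || (k + 2 < n)%N.
    rewrite lt0n; case: eqP rn => // -> rn.
    rewrite ltn_neqAle eq_sym addn2 -addn1 kn andbT.
    by apply/eqP => nk; case: rn; rewrite nk addn2 addn1.
  rewrite !hE ?subn_gt0 //; try by lia.
  (* Elimination starts from [n = k + 3]; [m = 0] is [n = k + 2], treated by hand. *)
  have [m nE] : exists m, n = (m.+2 + k)%N by exists (n - k - 2)%N; lia.
  case: m nE => [|m] nE.
    have r0 : (0 < r)%N by lia.
    rewrite nE (_ : 2 + k - 2 = k)%N; last by lia.
    rewrite (_ : 2 + k - 1 = 1 + k)%N; last by lia.
    rewrite (_ : 2 + k - k - 1 = 1)%N; last by lia.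
    rewrite (H0 r.+1 k) ?(H0 r.+1 1%N) ?(H0 r (2 + k - 3)%N); try by lia.
    rewrite !HS // (ends_failingS _ hX) // (ends_failing1 _ hX) //.
    (* For positive [r], u_r(1) = 0 and m_r(1) = [H r 1], as the elimination would demand. *)
    rewrite gtn_eqF // (ends_succeeding1_completes hk r0) -/(H r 1%N).
    rewrite (_ : 2 + k - 1 = 1 + k)%N; last by lia.
    rewrite (_ : 1 + k - 1 = k)%N; last by lia.
    ring.
  have := @eliminate_states R alpha beta ((1 - beta) * alpha ^+ (k - 1)) k
    (fun n => path_prob X (ends_failing k r n))
    (fun n => path_prob X (ends_succeeding k r n)) (H r) (H r.+1)
    (fun n => ends_failingS r hX hk (n := n))
    (fun n => ends_succeedingS r hX hk (n := n))
    (HS r) m.+1 isT.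
  rewrite nE => ->.
  rewrite (_ : m.+3 + k - 1 = m.+2 + k)%N; last by lia.
  rewrite (_ : m.+3 + k - 2 = m.+1 + k)%N; last by lia.
  rewrite (_ : m.+3 + k - 3 = m.+1 + k - 1)%N; last by lia.
  rewrite (_ : m.+3 + k - k - 1 = m.+2)%N; last by lia.
  ring.
- exact: waiting_pmf0.
- split.
  + by move=> n nk; rewrite hE // H0 //; lia.
  + by rewrite hE //; exact: completes_window_first hX hk.
  + rewrite hE // addnC HS // H0 ?orbT // (ends_failing1 _ hX) //= -hq; ring.
  + by move=> k1; rewrite h1 k1; ring.
  + by move=> k1; rewrite h1 k1 /= expr0; ring.
Qed.
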